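(* Let $X,Y,Z$ be pointed metric spaces, $0<q\le s\le\infty$, $0<r\le q$ and $p\ge q$. If $S\in\Pi^L_{(\mathfrak{m}^L(s;q),r)}(X,Y)$ and $T\in\Pi^L_{(p,\mathfrak{m}^L(s;q))}(Y,Z)$, then $T\circ S\in\Pi^L_{(p,\mathfrak{m}^L(r;r))}(X,Z)$. Moreover $$\pi^L_{(p,\mathfrak{m}^L(r;r))}(T\circ S)\le\pi^L_{(p,\mathfrak{m}^L(s;q))}(T)\cdot\pi^L_{(\mathfrak{m}^L(s;q),r)}(S).$$
   Context: For a metric space $X$ with base point $x_0$, $X^{\#}$ is the Banach space of real-valued Lipschitz functions on $X$ vanishing at $x_0$, with norm $Lip(\cdot)$ (the Lipschitz constant); $B_{X^{\#}}$ is its closed unit ball. $(\sigma,x',x'')$ denotes a finite sequence $(\sigma_j,x'_j,x''_j)_{j=1}^m$ in $\mathbb{R}\times X\times X$. Indices lie in $(0,\infty]$, $1/\infty=0$. Put $\|(\sigma,x',x'')|\ell_p\|=\big[\sum_j|\sigma_j|^p d_X(x'_j,x''_j)^p\big]^{1/p}$ and $\|(\sigma,x',x'')|\ell_p^{L,w}\|=\sup_{f\in B_{X^{\#}}}\big[\sum_j|\sigma_j|^p|f(x'_j)-f(x''_j)|^p\big]^{1/p}$ (sums replaced by suprema over $j$ if $p=\infty$). For $0<q\le s\le\infty$ let $s'(q)\in(0,\infty]$ be given by $\frac1{s'(q)}+\frac1s=\frac1q$, and put $\mathfrak{m}^L_{(s;q)}(\sigma,x',x'')=\inf_\tau\|\tau|\ell_{s'(q)}\|\,\|(\sigma/\tau,x',x'')|\ell_s^{L,w}\|$,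 the infimum over all $\tau=(\tau_j)$ with $\tau_j\in\mathbb{R}\setminus\{0\}$, where $\sigma/\tau=(\sigma_j/\tau_j)_j$. In particular $\mathfrak{m}^L_{(s;s)}(\sigma,x',x'')=\|(\sigma,x',x'')|\ell_s^{L,w}\|$. For $p\le q\le s$, a Lipschitz map $T:X\to Y$ is Lipschitz $(\mathfrak{m}^L(s;q),p)$-summing if there is $C\ge0$ with $\mathfrak{m}^L_{(s;q)}(\sigma,Tx',Tx'')\le C\,\|(\sigma,x',x'')|\ell_p^{L,w}\|$ for all finite sequences $(\sigma,x',x'')$; $\Pi^L_{(\mathfrak{m}^L(s;q),p)}(X,Y)$ is the class of all such maps and $\pi^L_{(\mathfrak{m}^L(s;q),p)}(T)$ is the infimum of such $C$. For $q\le s$ and $p\ge q$, a Lipschitz map $T:X\to Y$ is Lipschitz $(p,\mathfrak{m}^L(s;q))$-summing if there is $C\ge0$ with $\|(\sigma,Tx',Tx'')|\ell_p\|\le C\,\mathfrak{m}^L_{(s;q)}(\sigma,x',x'')$ for all finite sequences; $\Pi^L_{(p,\mathfrak{m}^L(s;q))}(X,Y)$ is the class of all such maps and $\pi^L_{(p,\mathfrak{m}^L(s;q))}(T)$ is the infimum of such $C$. *)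

(* Defs.v *)
From HB Require Import structures.
From mathcomp Require Import all_boot all_order all_algebra.
From mathcomp Require Import all_classical all_reals all_analysis.

Set Implicit Arguments.
Unset Strict Implicit.
Unset Printing Implicit Defensive.

Import Order.TTheory GRing.Theory Num.Theory.
Import numFieldNormedType.Exports.

Local Open Scope classical_set_scope.
Local Open Scope ring_scope.

(* Conventions.
   - A pointed metric space is a [metricType R] together with an explicit base
     point; maps between such spaces need not preserve the base points.
   - Indices live in [\bar R] and are meaningful only when positive.
   - A finite sequence in R * X * X is given by its length m and three families
     sg, x1, x2 indexed by 'I_m. *)

Definition lipschitz_constants (R : realType) (X Y : metricType R)
    (f : X -> Y) : set R :=
  [set k | 0 <= k /\ forall x y, mdist (f x) (f y) <= k * mdist x y].

Definition is_lipschitz (R : realType) (X Y : metricType R) (f : X -> Y) : Prop :=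
  exists k, lipschitz_constants f k.

(* +oo when f is not Lipschitz *)
Definition Lip (R : realType) (X Y : metricType R) (f : X -> Y) : \bar R :=
  ereal_inf [set k%:E | k in lipschitz_constants f].

Definition lip_dual (R : realType) (X : metricType R) (x0 : X) : set (X -> R^o) :=
  [set f : X -> R^o | is_lipschitz f /\ f x0 = 0].

Definition lip_dual_ball (R : realType) (X : metricType R) (x0 : X) :
    set (X -> R^o) :=
  [set f : X -> R^o | lip_dual x0 f /\ (Lip f <= 1)%E].

(* The l_p (quasi-)norm of a finite family; the value at -oo is junk. *)
Definition lp_norm (R : realType) (p : \bar R) (m : nat) (a : 'I_m -> R) : R :=
  match p with
  | p'%:E => (\sum_(j < m) `|a j| `^ p') `^ p'^-1
  | +oo%E => \big[Num.max/0]_(j < m) `|a j|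
  | -oo%E => 0
  end.

Definition lp_strong (R : realType) (X : metricType R) (p : \bar R) (m : nat)
    (sg : 'I_m -> R) (x1 x2 : 'I_m -> X) : R :=
  lp_norm p (fun j => `|sg j| * mdist (x1 j) (x2 j)).

Definition lp_weak (R : realType) (X : metricType R) (x0 : X) (p : \bar R)
    (m : nat) (sg : 'I_m -> R) (x1 x2 : 'I_m -> X) : \bar R :=
  ereal_sup [set (lp_norm p (fun j => `|sg j| * `|f (x1 j) - f (x2 j)|))%:E
            | f in lip_dual_ball x0].

(* The solution s'(q) of 1/s'(q) + 1/s = 1/q, using the extended inverse, for
   which 0^-1 = +oo and +oo^-1 = 0; in particular s'(s) = +oo. *)
Definition conj_index (R : realType) (s q : \bar R) : \bar R :=
  ((q^-1 - s^-1)^-1)%E.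

Definition mixed (R : realType) (X : metricType R) (x0 : X) (s q : \bar R)
    (m : nat) (sg : 'I_m -> R) (x1 x2 : 'I_m -> X) : \bar R :=
  ereal_inf [set ((lp_norm (conj_index s q) tau)%:E *
                  lp_weak x0 s (fun j => (sg j / tau j)%R) x1 x2)%E
            | tau in [set tau : 'I_m -> R | forall j, tau j != 0]].

Section MixedTarget.
Context (R : realType) (X Y : metricType R) (x0 : X) (y0 : Y) (s q p : \bar R).

(* the constants C in the definition of a Lipschitz (m^L(s;q), p)-summing map *)
Definition mixed_summing_constants (T : X -> Y) : set R :=
  [set C | 0 <= C /\
    forall (m : nat) (sg : 'I_m -> R) (x1 x2 : 'I_m -> X),
      (mixed y0 s q sg (T \o x1) (T \o x2) <= C%:E * lp_weak x0 p sg x1 x2)%E].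

Definition Pi_mixed_summing : set (X -> Y) :=
  [set T | is_lipschitz T /\ exists C, mixed_summing_constants T C].

Definition pi_mixed_summing (T : X -> Y) : \bar R :=
  ereal_inf [set C%:E | C in mixed_summing_constants T].

End MixedTarget.

Section MixedSource.
Context (R : realType) (X Y : metricType R) (x0 : X) (p s q : \bar R).

(* the constants C in the definition of a Lipschitz (p, m^L(s;q))-summing map *)
Definition summing_mixed_constants (T : X -> Y) : set R :=
  [set C | 0 <= C /\
    forall (m : nat) (sg : 'I_m -> R) (x1 x2 : 'I_m -> X),
      ((lp_strong p sg (T \o x1) (T \o x2))%:E <= C%:E * mixed x0 s q sg x1 x2)%E].

Definition Pi_summing_mixed : set (X -> Y) :=
  [set T | is_lipschitz T /\ exists C, summing_mixed_constants T C].

Definition pi_summing_mixed (T : X -> Y) : \bar R :=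
  ereal_inf [set C%:E | C in summing_mixed_constants T].

End MixedSource.

(* Main.v *)
Require Import Defs.
From mathcomp Require Import all_boot all_order all_algebra.
From mathcomp Require Import all_classical all_reals all_analysis.

Import Order.TTheory GRing.Theory Num.Theory.

Local Open Scope classical_set_scope.
Local Open Scope ereal_scope.

(** The point is that the (r;r)-mixed norm of a sequence in X is bounded below
    by its weak l_r norm [lp_weak_le_mixed]: here the conjugate index is
    infinite, and scaling the weights by tau changes a weak l_r norm by at most
    the supremum of |tau|.  Constants A for T and B for S then chain through
    the (s;q)-mixed norm of the image sequence in Y:
<<
      |(sg, TSx', TSx'') | l_p|  <=  A m_(s;q)(sg, Sx', Sx'')
                                 <=  A B |(sg, x', x'') | l_r^(L,w)|
                                 <=  A B m_(r;r)(sg, x', x'').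
>>
    So A B is a constant for T \o S [summing_mixed_comp].  The estimate between
    the optimal constants follows because a bound by all products a b passes to
    the product of the two infima [le_mul_ereal_inf].  That passage needs care
    only for the indeterminate form 0 * +oo, and it is excluded since both
    sets of constants are inhabited. *)

Lemma is_lipschitz_comp (R : realType) (X Y Z : metricType R)
    (S : X -> Y) (T : Y -> Z) :
  is_lipschitz S -> is_lipschitz T -> is_lipschitz (T \o S).
Proof.
move=> [k [k0 Sk]] [l [l0 Tl]]; exists (l * k)%R; split; first exact: mulr_ge0.
move=> x y /=; apply: le_trans (Tl _ _) _.
by rewrite -mulrA ler_wpM2l.
Qed.

Lemma conj_indexxx (R : realType) (r : \bar R) : 0 < r -> conj_index r r = +oo.
Proof.
move=> r_gt0; rewrite /conj_index subee ?inve0//.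
by rewrite fin_numV// gt_eqF// (lt_trans (ltNyr 0%R) r_gt0).
Qed.

Lemma lp_norm_le_scale (R : realType) (p : \bar R) (c : R) (m : nat)
    (a b : 'I_m -> R) :
  0 < p -> (0 <= c)%R -> (forall j, `|a j| <= c * `|b j|)%R ->
  (lp_norm p a <= c * lp_norm p b)%R.
Proof.
case: p => [p| |] //= p_gt0 c_ge0 le_ab; last first.
  apply: bigmax_le => [|j _].
    by rewrite mulr_ge0//; apply: bigmax_ge_id.
  apply: le_trans (le_ab j) _; rewrite ler_wpM2l//.
  exact: (le_bigmax _ (fun j => `|b j|%R)).
rewrite lte_fin in p_gt0.
have -> : c = ((c `^ p) `^ p^-1)%R by rewrite -powRrM mulfV ?gt_eqF// powRr1.
rewrite -powRM ?powR_ge0 ?sumr_ge0//.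
rewrite mulr_sumr; apply: ge0_ler_powR.
- by rewrite invr_ge0 ltW.
- by rewrite nnegrE sumr_ge0// => j _; rewrite powR_ge0.
- by rewrite nnegrE sumr_ge0// => j _; rewrite mulr_ge0 ?powR_ge0.
apply: ler_sum => j _; rewrite -powRM//; apply: ge0_ler_powR (le_ab j).
- exact: ltW.
- by rewrite nnegrE.
- by rewrite nnegrE mulr_ge0.
Qed.

(** Termwise |sg| = |tau| |sg / tau|, and |tau| is at most its maximum, which is
    the norm of tau at the infinite conjugate index. *)
Lemma lp_weak_le_mixed (R : realType) (X : metricType R) (x0 : X) (r : \bar R)
    (m : nat) (sg : 'I_m -> R) (x1 x2 : 'I_m -> X) :
  0 < r -> lp_weak x0 r sg x1 x2 <= mixed x0 r r sg x1 x2.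
Proof.
move=> r_gt0; apply: le_ereal_inf_tmp => _ [tau tau_neq0 <-].
rewrite conj_indexxx//; set M := lp_norm _ tau.
have M_ge0 : (0 <= M)%R by apply: bigmax_ge_id.
apply: ge_ereal_sup => _ [f f_ball <-].
apply: (@le_trans _ _ (M%:E *
  (lp_norm r (fun j => `|sg j / tau j| * `|f (x1 j) - f (x2 j)|)%R)%:E)).
  rewrite -EFinM lee_fin; apply: lp_norm_le_scale => // j.
  rewrite !normrM !normr_id mulrA ler_wpM2r// mulrC normfV -mulrA.
  rewrite ler_peMr// mulrC ler_pdivlMr ?normr_gt0// mul1r.
  exact: (le_bigmax _ (fun j => `|tau j|%R)).
apply: lee_wpmul2l; first by rewrite lee_fin.
by apply: ereal_sup_ubound; exists f.
Qed.

Lemma summing_mixed_comp (R : realType) (X Y Z : metricType R)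
    (x0 : X) (y0 : Y) (p q r s : \bar R) (S : X -> Y) (T : Y -> Z) (A B : R) :
  0 < r -> summing_mixed_constants y0 p s q T A ->
  mixed_summing_constants x0 y0 s q r S B ->
  summing_mixed_constants x0 p r r (T \o S) (A * B)%R.
Proof.
move=> r_gt0 [A_ge0 TA] [B_ge0 SB]; split; first exact: mulr_ge0.
move=> m sg x1 x2; apply: le_trans (TA m sg (S \o x1) (S \o x2)) _.
rewrite EFinM -muleA; apply: lee_wpmul2l; first by rewrite lee_fin.
apply: le_trans (SB m sg x1 x2) _.
apply: lee_wpmul2l; first by rewrite lee_fin.
exact: lp_weak_le_mixed.
Qed.

(** When [k] is 0 the right-hand side is 0, even if the infimum is +oo; an
    element of [A] is then what forces [x <= 0]. *)
Lemma le_ereal_inf_mulr (R : realType) (A : set (\bar R)) (x : \bar R) (k : R) :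
  (0 <= k)%R -> A !=set0 -> (forall a, A a -> x <= a * k%:E) ->
  x <= ereal_inf A * k%:E.
Proof.
rewrite le_eqVlt => /predU1P[<- [a Aa] /(_ a Aa)|k_gt0 _ xA].
  by rewrite !mule0.
rewrite -lee_pdivrMr//; apply: le_ereal_inf_tmp => a Aa.
by rewrite lee_pdivrMr// xA.
Qed.

Lemma ereal_inf_ge0_fin_num (R : realType) (A : set R) :
  A !=set0 -> (forall a, A a -> 0 <= a)%R ->
  0 <= ereal_inf (EFin @` A) /\ ereal_inf (EFin @` A) \is a fin_num.
Proof.
move=> [a Aa] A_ge0; have inf_ge0 : 0 <= ereal_inf (EFin @` A).
  by apply: le_ereal_inf_tmp => _ [b Ab <-]; rewrite lee_fin A_ge0.
split=> //; rewrite ge0_fin_numE//; apply: le_lt_trans (ltry a).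
by apply: ereal_inf_lbound; exists a.
Qed.

(** Taking the infimum over one factor at a time makes each step the scaling of
    an infimum by a finite nonnegative real. *)
Lemma le_mul_ereal_inf (R : realType) (A B : set R) (x : \bar R) :
  A !=set0 -> B !=set0 ->
  (forall a, A a -> 0 <= a)%R -> (forall b, B b -> 0 <= b)%R ->
  (forall a b, A a -> B b -> x <= (a * b)%:E) ->
  x <= ereal_inf (EFin @` A) * ereal_inf (EFin @` B).
Proof.
move=> A0 B0 A_ge0 B_ge0 xAB.
have [infA_ge0 infA_fin] := ereal_inf_ge0_fin_num _ _ A0 A_ge0.
have image_neq0 (D : set R) : D !=set0 -> (EFin @` D) !=set0.
  by move=> [d Dd]; exists d%:E, d.
rewrite muleC -(fineK infA_fin); apply: le_ereal_inf_mulr.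
- exact: fine_ge0.
- exact: image_neq0.
move=> _ [b Bb <-]; rewrite fineK// muleC; apply: le_ereal_inf_mulr.
- exact: B_ge0.
- exact: image_neq0.
by move=> _ [a Aa <-]; rewrite -EFinM xAB.
Qed.

Theorem proposition4p10 (R : realType) (X Y Z : metricType R)
    (x0 : X) (y0 : Y) (z0 : Z) (p q r s : \bar R)
    (q_gt0 : 0 < q) (le_qs : q <= s) (r_gt0 : 0 < r) (le_rq : r <= q)
    (le_qp : q <= p) (S : X -> Y) (T : Y -> Z)
    (S_summing : Pi_mixed_summing x0 y0 s q r S)
    (T_summing : Pi_summing_mixed y0 p s q T) :
  Pi_summing_mixed x0 p r r (T \o S) /\
  pi_summing_mixed x0 p r r (T \o S) <=
    pi_summing_mixed y0 p s q T * pi_mixed_summing x0 y0 s q r S.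
Proof.
have [S_lip [B SB]] := S_summing; have [T_lip [A TA]] := T_summing.
have TS_constant a b : summing_mixed_constants y0 p s q T a ->
    mixed_summing_constants x0 y0 s q r S b ->
    summing_mixed_constants x0 p r r (T \o S) (a * b)%R.
  exact: summing_mixed_comp.
split.
  by split; [exact: is_lipschitz_comp|exists (A * B)%R; exact: TS_constant].
apply: le_mul_ereal_inf.
- by exists A.
- by exists B.
- by move=> a [].
- by move=> b [].
move=> a b Ta Sb; apply: ereal_inf_lbound.
by exists (a * b)%R => //; exact: TS_constant.
Qed.
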